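(* Let $\alpha\in(0,1)$, $\mu>0$ and $q=(1+(1-\alpha)\mu)^{-1}$. Let $\{X_t\}$ be a stationary INAR(1) process with prespecified $NB(1,\mu)$ marginal distribution and $NB(1,(1-\alpha)\mu)$ innovation distribution (driven by the thinning operator $(\alpha,\mu)\star(\cdot)$). Then for all $i,j\ge0$ the transition probability $p_{ij}=P(X_{t+1}=j\mid X_t=i)$ is $$p_{ij}=\begin{cases} q(1-q)^j & \text{if } i=0,\\[4pt] \displaystyle A_0^{(i)}(\alpha q)B_1^{(j+1)}(q)+\sum_{k=1}^{j}B_1^{(j-k+1)}(q)\sum_{l=1}^{\min(i,k)}A_l^{(i)}(\alpha q)B_l^{(k)}(q) & \text{if } i\ge1.\end{cases}$$
   Context: $\mathbb{Z}_+=\{0,1,2,\dots\}$; pgf means probability generating function. For $r,m>0$, $NB(r,m)$ is the distribution on $\mathbb{Z}_+$ with pgf $(1+m r^{-1}(1-s))^{-r}$ (its mean is $m$). For $\alpha\in(0,1)$ and $\mu>0$, the thinning operator $(\alpha,\mu)\star(\cdot)$ acts on a $\mathbb{Z}_+$-valued random variable $X$ by $(\alpha,\mu)\star X=\sum_{i=1}^{X}G_i$, where $(G_i)_{i\ge1}$ is i.i.d., $\mathbb{Z}_+$-valued, independent of $X$, with pgf $$\Psi_G(s)=1-\alpha\frac{1-s}{1+(1-\alpha)\mu(1-s)}.$$ The INAR(1) process is the $\mathbb{Z}_+$-valued process satisfying $X_{t+1}=(\alpha,\mu)\star X_t+\varepsilon_{t+1}$, $t\ge0$, where the innovations $(\varepsilon_t)$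 are i.i.d. and independent of the counting variables $G_i$ (a Galton–Watson branching process with immigration: fresh copies of the $G_i$ are used at each time, and these and $\varepsilon_{t+1}$ are independent of $X_0,\dots,X_t$). Here $\varepsilon_t\sim NB(1,(1-\alpha)\mu)$, and stationarity is achieved by $X_0\sim NB(1,\mu)$. For $n\ge1$, $0\le i\le n$, $1\le l\le n$ and $0<y<1$, $$A_i^{(n)}(y)=\binom{n}{i}y^i(1-y)^{n-i},\qquad B_l^{(n)}(y)=\binom{n-1}{l-1}y^l(1-y)^{n-l}.$$ Empty sums are $0$. *)

(* Defs.v *)
From HB Require Import structures.
From mathcomp Require Import all_boot all_order all_algebra.
From mathcomp Require Import all_classical all_reals all_analysis.
Import Order.TTheory GRing.Theory Num.Theory.
Import numFieldNormedType.Exports.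

Set Implicit Arguments.
Unset Strict Implicit.
Unset Printing Implicit Defensive.

Local Open Scope classical_set_scope.
Local Open Scope ring_scope.

Definition mutual_independence d (T : measurableType d) (R : realType)
    (P : probability T R) (I : choiceType) (Y : I -> {RV P >-> nat}) : Prop :=
  forall (s : seq I) (A : I -> set nat), uniq s ->
    P (\bigcap_(i in [set` s]) (Y i @^-1` A i)) =
    (\prod_(i <- s) P (Y i @^-1` A i))%E.

(* The cylinder events below form pi-systems generating the sigma-algebras of
   Y and of Z, so this is independence of the random vectors
   (Y i)_i and (Z k)_k. *)
Definition independent_families d (T : measurableType d) (R : realType)
    (P : probability T R) (I K : choiceType)
    (Y : I -> {RV P >-> nat}) (Z : K -> {RV P >-> nat}) : Prop :=
  forall (s : seq I) (u : seq K) (A : I -> set nat) (B : K -> set nat),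
    P (\bigcap_(i in [set` s]) (Y i @^-1` A i) `&`
       \bigcap_(k in [set` u]) (Z k @^-1` B k)) =
    (P (\bigcap_(i in [set` s]) (Y i @^-1` A i)) *
     P (\bigcap_(k in [set` u]) (Z k @^-1` B k)))%E.

Definition stationary d (T : measurableType d) (R : realType)
    (P : probability T R) (X : nat -> {RV P >-> nat}) : Prop :=
  forall (h : nat) (s : seq nat) (A : nat -> set nat),
    P (\bigcap_(t in [set` s]) (X (t + h)%N @^-1` A t)) =
    P (\bigcap_(t in [set` s]) (X t @^-1` A t)).

Definition pgf d (T : measurableType d) (R : realType)
    (P : probability T R) (X : {RV P >-> nat}) (s : R) : \bar R :=
  'E_P[fun w => s ^+ X w].

Definition has_pgf d (T : measurableType d) (R : realType)
    (P : probability T R) (X : {RV P >-> nat}) (Psi : R -> R) : Prop :=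
  forall s : R, 0 <= s <= 1 -> pgf X s = (Psi s)%:E.

Definition NB_pgf (R : realType) (r m s : R) : R :=
  (1 + m * r^-1 * (1 - s)) `^ (- r).

Definition G_pgf (R : realType) (alpha mu s : R) : R :=
  1 - alpha * ((1 - s) / (1 + (1 - alpha) * mu * (1 - s))).

(* The counting variables G_1, G_2, ... are numbered from 0. *)
Definition thinning (T : Type) (G : nat -> T -> nat) (X : T -> nat) (w : T) :
    nat :=
  (\sum_(i < X w) G i w)%N.

(* G t i is the i-th counting variable used in the passage from X t to
   X t.+1; the innovations are eps 1, eps 2, ..., and eps 0 is unused. *)
Definition driving d (T : measurableType d) (R : realType)
    (P : probability T R) (G : nat -> nat -> {RV P >-> nat})
    (eps : nat -> {RV P >-> nat}) (a : nat * nat + nat) : {RV P >-> nat} :=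
  match a with
  | inl (t, i) => G t i
  | inr t => eps t.+1
  end.

Definition step_driving d (T : measurableType d) (R : realType)
    (P : probability T R) (G : nat -> nat -> {RV P >-> nat})
    (eps : nat -> {RV P >-> nat}) (t : nat) (a : option nat) : {RV P >-> nat} :=
  match a with
  | Some i => G t i
  | None => eps t.+1
  end.

Record INAR1 d (T : measurableType d) (R : realType) (P : probability T R)
    (alpha mu : R) (Psi_eps : R -> R) (X : nat -> {RV P >-> nat})
    (G : nat -> nat -> {RV P >-> nat}) (eps : nat -> {RV P >-> nat}) : Prop := {
  INAR1_rec : forall (t : nat) (w : T),
    X t.+1 w = (thinning (fun i => G t i : T -> nat) (X t) w + eps t.+1 w)%N ;
  INAR1_counting : forall t i : nat, has_pgf (G t i) (G_pgf alpha mu) ;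
  INAR1_innovation : forall t : nat, has_pgf (eps t.+1) Psi_eps ;
  INAR1_driving : mutual_independence (driving G eps) ;
  INAR1_past : forall t : nat,
    independent_families (step_driving G eps t) (fun k : 'I_t.+1 => X k) }.

Definition cond_prob d (T : measurableType d) (R : realType)
    (P : probability T R) (E F : set T) : R :=
  fine (P (E `&` F)) / fine (P F).

Definition A_coef (R : realType) (n i : nat) (y : R) : R :=
  'C(n, i)%:R * y ^+ i * (1 - y) ^+ (n - i).

Definition B_coef (R : realType) (n l : nat) (y : R) : R :=
  'C(n.-1, l.-1)%:R * y ^+ l * (1 - y) ^+ (n - l).

(* Main.v *)
(* The counting law is zero-modified geometric: its pgf is
   1 - alpha q + alpha q H(s), where H(s) = q s / (1 - (1 - q) s) is the pgf of
   the geometric law on {1, 2, ...}; the innovation is geometric on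
   {0, 1, ...}. Given X_t = i, the next state is a sum of i independent counting
   variables and one innovation, hence p_ij is the j-th coefficient of the
   product of their pgfs. The binomial theorem for the i-th power, together with
   the negative binomial coefficients of H ^ l, gives the double sum. *)

Require Import Defs.
From HB Require Import structures.
From mathcomp Require Import all_boot all_order all_algebra.
From mathcomp Require Import all_classical all_reals all_analysis.
From mathcomp Require Import measurable_realfun ring lra.
Import Order.TTheory GRing.Theory Num.Theory.
Import numFieldNormedType.Exports.

Set Implicit Arguments.
Unset Strict Implicit.
Unset Printing Implicit Defensive.

Local Open Scope classical_set_scope.
Local Open Scope ring_scope.

(** * Polynomial expansions with explicit remainder *)

(* Only finite sums and an explicit remainder occur, so that a law is read off
   its pgf without any theory of power series. *)
Definition expands_as (R : realType) (f : R -> R) (a : nat -> R) : Prop :=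
  exists C : R, forall (n : nat) (s : R), 0 <= s <= 1 ->
    `|f s - \sum_(k < n) a k * s ^+ k| <= C * s ^+ n.

(** Strong induction: once the coefficients below [n] agree, comparing the two expansions of length
    [n.+1] bounds [|a n - b n| * s ^+ n] by [(C + D) * s ^+ n.+1]. Divide by [s ^+ n] and let [s]
    tend to 0. *)
Lemma expands_as_unique (R : realType) (f : R -> R) (a b : nat -> R) :
  expands_as f a -> expands_as f b -> a =1 b.
Proof.
move=> [C fa] [D fb] n; elim/ltn_ind: n => n IH.
have small s : 0 < s <= 1 -> `|a n - b n| <= (C + D) * s.
  move=> /andP[s0 s1]; have s01 : 0 <= s <= 1 by rewrite ltW.
  rewrite -(@ler_pM2r _ (s ^+ n)) ?exprn_gt0//.
  have -> : `|a n - b n| * s ^+ n =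
      `|(f s - \sum_(k < n.+1) b k * s ^+ k) -
        (f s - \sum_(k < n.+1) a k * s ^+ k)|.
    have E : \sum_(k < n) a k * s ^+ k = \sum_(k < n) b k * s ^+ k.
      by apply: eq_bigr => k _; rewrite IH.
    rewrite !big_ord_recr /= E -[X in _ * X]ger0_norm ?exprn_ge0 ?ltW// -normrM.
    congr (`|_|); ring.
  apply: le_trans (ler_normB _ _) _; rewrite addrC -mulrA -exprS mulrDl.
  exact: lerD (fa _ _ s01) (fb _ _ s01).
have CD0 : 0 <= C + D.
  by have := small 1; rewrite ltr01 lexx mulr1 => /(_ isT); apply: le_trans.
apply/eqP; rewrite -subr_eq0 -normr_le0.
apply/ler_addgt0Pl => e e0; rewrite addr0.
(* The added 1 keeps the denominator of the chosen [s] positive even when [C + D] is 0. *)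
have p0 : 0 < C + D + 1 by rewrite ltr_wpDl.
have m0 : 0 < Num.min 1 (e / (C + D + 1)) by rewrite lt_min ltr01 divr_gt0.
apply: le_trans (small (Num.min 1 (e / (C + D + 1))) _) _.
  by rewrite m0 ge_min lexx.
apply: (@le_trans _ _ ((C + D + 1) * (e / (C + D + 1)))).
  apply: ler_pM => //; first exact: ltW.
    by rewrite lerDl ler01.
  by rewrite ge_min lexx orbT.
by rewrite mulrC divfK ?gt_eqF.
Qed.

Lemma eq_expands_as (R : realType) (f g : R -> R) (a : nat -> R) :
  (forall s, 0 <= s <= 1 -> f s = g s) -> expands_as f a -> expands_as g a.
Proof. by move=> fg [C fa]; exists C => n s s01; rewrite -fg//; exact: fa. Qed.

(** The remainder is exactly the function times [((1 - q) * s) ^+ n], and both the function and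
    [(1 - q) ^+ n] are at most 1; hence the constant 1. *)
Lemma expands_as_geometric (R : realType) (q : R) : 0 < q <= 1 ->
  expands_as (fun s => q / (1 - (1 - q) * s)) (fun k => q * (1 - q) ^+ k).
Proof.
move=> /andP[q0 q1]; exists 1 => n s /andP[s0 s1].
have d0 : 0 < 1 - (1 - q) * s by nra.
have -> : q / (1 - (1 - q) * s) - \sum_(k < n) q * (1 - q) ^+ k * s ^+ k =
    q / (1 - (1 - q) * s) * ((1 - q) * s) ^+ n.
  rewrite (eq_bigr (fun k : 'I_n => q * ((1 - q) * s) ^+ k)); last first.
    by move=> k _; rewrite exprMn mulrA.
  rewrite -mulr_sumr; have := subrX1 ((1 - q) * s) n.
  set S := \sum_(i < n) _; set r := _ * s in d0 *; move=> E.
  have -> : r ^+ n = 1 + (r - 1) * S by rewrite -E; ring.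
  by field; rewrite gt_eqF.
have c1 : q / (1 - (1 - q) * s) <= 1 by rewrite ler_pdivrMr// mul1r; nra.
have c0 : 0 <= q / (1 - (1 - q) * s) by rewrite divr_ge0// ltW.
have r0 : 0 <= (1 - q) ^+ n by rewrite exprn_ge0 ?subr_ge0.
rewrite ger0_norm; last first.
  by apply: mulr_ge0 => //; rewrite exprn_ge0 ?mulr_ge0 ?subr_ge0.
rewrite exprMn mulrA ler_wpM2r ?exprn_ge0// mulr_ile1 ?exprn_ile1 ?subr_ge0//.
by rewrite lerBlDr lerDl ltW.
Qed.

Lemma expands_as_shift (R : realType) (f : R -> R) (a : nat -> R) (c e : R) :
  expands_as f a ->
  expands_as (fun s => c + e * (s * f s))
    (fun k => if k is k'.+1 then e * a k' else c).
Proof.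
move=> [C fa]; have := fa 0%N 1; rewrite ler01 lexx expr0 mulr1 big_ord0 subr0.
move=> /(_ isT) C0; have {}C0 : 0 <= C by apply: le_trans C0.
(* [|c|] is spent at order 0, where nothing is subtracted. At order [n.+1] the constant term cancels
   and the factor [s] lifts the remainder of [f] by one order. *)
exists (`|c| + `|e| * C) => -[|n] s s01; have /andP[s0 s1] := s01.
  rewrite big_ord0 subr0 expr0 mulr1.
  apply: le_trans (ler_normD _ _) _; rewrite lerD2l normrM ler_wpM2l//.
  have := fa 0%N s s01; rewrite big_ord0 subr0 expr0 mulr1 => fC.
  by rewrite normrM (ger0_norm s0) (le_trans _ fC)// ler_piMl.
rewrite big_ord_recl /= expr0 mulr1.
have -> : c + e * (s * f s) - (c + \sum_(i < n) e * a i * s ^+ i.+1) =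
    e * (s * (f s - \sum_(i < n) a i * s ^+ i)).
  rewrite (eq_bigr (fun i : 'I_n => e * s * (a i * s ^+ i))) -?mulr_sumr.
    by ring.
  by move=> i _; rewrite exprS; ring.
rewrite !normrM (ger0_norm s0) exprS mulrDl -[leLHS]add0r lerD//.
  by rewrite mulr_ge0// mulr_ge0// exprn_ge0.
by rewrite -mulrA ler_wpM2l// mulrCA ler_wpM2l// fa.
Qed.

(** * Reading a law off its pgf *)

Lemma measurable_fun_nat (d : measure_display) (T : measurableType d)
    (R : realType) (P : probability T R) (X : {RV P >-> nat}) (h : nat -> R) :
  measurable_fun setT (fun w => (h (X w))%:E : \bar R).
Proof.
apply/measurable_EFinP.
have mh : measurable_fun setT h by [].
exact: (measurableT_comp mh (measurable_funPT X)).
Qed.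

Lemma measurable_RV_preimage (d : measure_display) (T : measurableType d)
    (R : realType) (P : probability T R) (X : {RV P >-> nat}) (A : set nat) :
  measurable (X @^-1` A).
Proof. exact: measurable_funPTI. Qed.

(** The part of the expectation over [X < n] is the partial sum itself; the part over [X >= n] lies
    between 0 and [s ^+ n] because [s <= 1]. *)
Lemma pgf_expands_as (d : measure_display) (T : measurableType d)
    (R : realType) (P : probability T R) (X : {RV P >-> nat}) (Psi : R -> R) :
  has_pgf X Psi -> expands_as Psi (fun k => fine (P [set w | X w = k])).
Proof.
move=> hX; exists 1 => n s s01; have /andP[s0 s1] := s01.
have mX (A : set nat) : measurable (X @^-1` A) by exact: measurable_RV_preimage.
have mf (D : set T) : measurable_fun D (fun w => (s ^+ X w)%:E).
  exact: measurable_funTS (measurable_fun_nat X (fun k => s ^+ k)).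
have f0 (w : T) : (0 <= (s ^+ X w)%:E)%E by rewrite lee_fin exprn_ge0.
have lowE : (\int[P]_(w in X @^-1` [set k | (k < n)%N]) (s ^+ X w)%:E =
    (\sum_(k < n) fine (P [set w | X w = k]) * s ^+ k)%:E)%E.
  have -> : X @^-1` [set k | (k < n)%N] =
      \big[setU/set0]_(k <- index_enum 'I_n) (X @^-1` [set val k]).
    rewrite -bigcup_seq; apply/seteqP; split => w /=.
      by move=> Xn; exists (Ordinal Xn) => //=; rewrite mem_index_enum.
    by move=> [k _ /= ->].
  rewrite ge0_integral_bigsetU ?index_enum_uniq//; last first.
    by move=> k l _ _ [w [/= -> /val_inj]].
  rewrite -sumEFin; apply: eq_bigr => k _.
  rewrite (eq_integral (cst (s ^+ k)%:E)); last first.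
    by move=> w; rewrite inE/= => ->.
  rewrite integral_cst// muleC EFinM fineK//.
  by apply: fin_num_measure; exact: (mX [set val k]).
have highE : (0 <= \int[P]_(w in X @^-1` [set k | (n <= k)%N]) (s ^+ X w)%:E
    <= (s ^+ n)%:E)%E.
  apply/andP; split; first exact: integral_ge0.
  apply: le_trans (_ : \int[P]_(w in X @^-1` [set k | (n <= k)%N])
      cst (s ^+ n)%:E w <= _)%E.
    apply: ge0_le_integral => // w /= nX.
    by rewrite lee_fin ler_wiXn2l.
  rewrite integral_cst// muleC gee_pMl ?probability_le1 ?fin_num_measure//.
  by rewrite lee_fin exprn_ge0.
have := hX s s01; rewrite /pgf unlock.
have -> : [set: T] =
    X @^-1` [set k | (k < n)%N] `|` X @^-1` [set k | (n <= k)%N].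
  by apply/seteqP; split => w //= _; have [] := ltnP (X w) n; [left|right].
rewrite ge0_integral_setU//; last first.
  apply/disj_setPS => w [/=]; rewrite ltnNge => /negP.
  by [].
rewrite lowE; move: highE; case: (integral _ _ _) => [r| |]//=.
rewrite !lee_fin => /andP[r0 rn] [<-].
by rewrite addrAC subrr add0r ger0_norm// mul1r.
Qed.

(** * Powers of the geometric and zero-modified geometric series *)

(** Truncation of the series H: the coefficients of its powers at indices below [N] are those of the
    full series, so polynomial algebra suffices. *)
Definition geometric_poly (R : realType) (q : R) (N : nat) : {poly R} :=
  \poly_(m < N) (if m is m'.+1 then q * (1 - q) ^+ m' else 0).

Lemma coef0_geometric_poly (R : realType) (q : R) (N : nat) :
  (geometric_poly q N)`_0 = 0.
Proof. by rewrite coef_poly; case: ifP. Qed.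

Lemma coef0_exp (R : comNzRingType) (p : {poly R}) (n : nat) :
  (p ^+ n)`_0 = p`_0 ^+ n.
Proof. by rewrite -!horner_coef0 hornerE. Qed.

(** Coefficient form of H = q s + (1 - q) s H multiplied by H ^ l. *)
Lemma coef_geometric_poly_exprS_rec (R : realType) (q : R) (N l k : nat) :
  (k.+1 < N)%N ->
  (geometric_poly q N ^+ l.+1)`_k.+1 =
  (1 - q) * (geometric_poly q N ^+ l.+1)`_k + q * (geometric_poly q N ^+ l)`_k.
Proof.
move=> kN; rewrite exprS !coefM big_ord_recl coef0_geometric_poly mul0r add0r.
rewrite !(big_ord_recl k) coef0_geometric_poly mul0r add0r /= mulr_sumr.
rewrite (_ : bump 0 0 = 1%N)// subSS subn0 coef_poly /=.
rewrite (leq_ltn_trans _ kN)// expr0 mulr1 addrC; congr (_ + _).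
apply: eq_bigr => i _; rewrite /bump /= !add1n !subSS !coef_poly.
have iN : (i.+2 < N)%N by rewrite (leq_ltn_trans _ kN)// ltnS ltn_ord.
by rewrite iN (ltnW iN) exprS; ring.
Qed.

(* The l-fold convolution of the geometric law on {1, 2, ...} is negative
   binomial; the recursion above turns this into Pascal's rule. *)
Lemma coef_geometric_poly_exprS (R : realType) (q : R) (N l k : nat) :
  (k.+1 < N)%N ->
  (geometric_poly q N ^+ l.+1)`_k.+1 = B_coef k.+1 l.+1 q.
Proof.
rewrite /B_coef /= subSS; elim: l k => [|l IHl] k; elim: k => [|k IHk] kN;
  rewrite coef_geometric_poly_exprS_rec//.
- by rewrite expr1 coef0_geometric_poly expr0 coef1 bin0 subn0 /=; ring.
- by rewrite IHk ?(ltnW kN)// expr0 coef1 !bin0 !subn0 (exprS _ k) /=; ring.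
- rewrite !coef0_exp !coef0_geometric_poly !expr0n /=.
  by case: l {IHl} => *; rewrite ?bin0n ?bin_small//=; ring.
rewrite IHk ?(ltnW kN)// IHl ?(ltnW kN)// binS natrD subSS.
(* Truncated subtraction breaks [(1 - q) * (1 - q) ^+ (k - l.+1) = (1 - q) ^+ (k - l)] when
   [k <= l], but then its coefficient ['C(k, l.+1)] is 0. *)
have [kl|lk] := leqP k l; first by rewrite (@bin_small k l.+1)//= !exprS; ring.
by rewrite -(subnSK lk) !exprS; ring.
Qed.

(** Binomial theorem, with [l] the number of nonzero summands among [i]. Terms with [l > k.+1]
    vanish, whence the minimum. *)
Lemma coef_zero_modified_exp (R : realType) (q y : R) (N i k : nat) :
  (k.+1 < N)%N ->
  (((1 - y)%:P + y *: geometric_poly q N) ^+ i)`_k.+1 =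
  \sum_(1 <= l < (minn i k.+1).+1) A_coef i l y * B_coef k.+1 l q.
Proof.
move=> kN; rewrite exprDn coef_sum.
(* The term [l = 0] is a constant polynomial and gives 0 here, whereas [B_coef k.+1 0 q] is
   [(1 - q) ^+ k.+1] since [0.-1 = 0]; it must be treated apart. *)
rewrite (eq_bigr (fun l : 'I_i.+1 =>
  if l == 0%N :> nat then 0 else A_coef i l y * B_coef k.+1 l q)); last first.
  move=> [l /= _] _.
  rewrite coefMn exprZn -polyC_exp -scalerAr mul_polyC !coefZ.
  case: l => [|l]; first by rewrite /= expr0 coef1 /= !mulr0 mul0rn.
  by rewrite coef_geometric_poly_exprS// /A_coef -mulr_natl; ring.
rewrite -(big_mkord xpredT (fun l =>
  if l == 0%N then 0 else A_coef i l y * B_coef k.+1 l q)).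
rewrite big_nat_recl//= add0r big_add1 /=.
rewrite (big_cat_nat (n := minn i k.+1))//=; last exact: geq_minl.
rewrite [X in _ + X]big_nat_cond [X in _ + X]big1 ?addr0// => l /andP[/andP[]].
rewrite geq_min => /orP[il|kl] li _; first by rewrite ltnNge il in li.
by rewrite /B_coef /= bin_small// !mul0r mulr0.
Qed.

(** * Law of a finite independent sum as a coefficient of a product *)

Lemma coef_prod_poly (R : comNzRingType) (I : finType) (p : I -> nat -> R)
    (j : nat) :
  (\prod_a \poly_(m < j.+1) p a m)`_j =
  \sum_(f : {ffun I -> 'I_j.+1} | (\sum_a f a)%N == j) \prod_a p a (f a).
Proof.
rewrite (eq_bigr (fun a => \sum_(m < j.+1) p a m *: 'X^m)); last first.
  by move=> a _; rewrite poly_def.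
rewrite bigA_distr_bigA coef_sum [RHS]big_mkcond; apply: eq_bigr => f _.
rewrite scaler_prod prodrXr coefZ coefXn eq_sym.
by case: eqP => _; rewrite ?mulr1 ?mulr0.
Qed.

(** A sum equal to [j] forces every summand to be at most [j], so the event is a finite disjoint
    union over value assignments [f] with total [j], and each piece factors. *)
Lemma prob_sum_eq (d : measure_display) (T : measurableType d) (R : realType)
    (P : probability T R) (I : finType) (Y : I -> {RV P >-> nat}) (E : set T)
    (j : nat) :
  measurable E ->
  (forall f : I -> nat, P (E `&` \bigcap_a (Y a @^-1` [set f a])) =
     (P E * \prod_a P (Y a @^-1` [set f a]))%E) ->
  fine (P (E `&` [set w | (\sum_a Y a w)%N = j])) =
  fine (P E) * (\prod_a \poly_(m < j.+1) fine (P [set w | Y a w = m]))`_j.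
Proof.
move=> mE indep.
have mY (a : I) (A : set nat) : measurable (Y a @^-1` A).
  exact: measurable_RV_preimage.
pose F (f : {ffun I -> 'I_j.+1}) : set T :=
  E `&` \bigcap_a (Y a @^-1` [set (f a : nat)]).
pose s := enum [pred f : {ffun I -> 'I_j.+1} | (\sum_a f a)%N == j].
have -> : E `&` [set w | (\sum_a Y a w)%N = j] = \bigcup_(f in [set` s]) F f.
  apply/seteqP; split => w /=.
    move=> [Ew Yw].
    have Yj a : (Y a w < j.+1)%N by rewrite ltnS -Yw (bigD1 a)//= leq_addr.
    exists [ffun a => Ordinal (Yj a)].
      rewrite /= mem_enum inE -[X in _ == X]Yw; apply/eqP/eq_bigr => a _.
      by rewrite ffunE.
    by split => // a _ /=; rewrite ffunE.
  move=> [f /=]; rewrite mem_enum inE => /eqP fj [Ew Yf]; split => //.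
  by rewrite -[RHS]fj; apply: eq_bigr => a _; exact: Yf.
rewrite measure_fin_bigcup//; last 2 first.
- move=> f g _ _ [w [[_ fw] [_ gw]]]; apply/ffunP => a; apply/val_inj.
  by rewrite /= -(fw a Logic.I) -(gw a Logic.I).
- by move=> f _; apply: measurableI => //; apply: fin_bigcap_measurable.
rewrite -fsbig_seq ?enum_uniq// big_enum.
rewrite (eq_bigr (fun f : {ffun I -> 'I_j.+1} =>
    (fine (P E) * \prod_a fine (P [set w | Y a w = f a]))%:E)); last first.
  move=> f _; rewrite /F; have /= -> := indep (fun a => f a : nat).
  rewrite EFinM -prodEFin fineK ?fin_num_measure//.
  congr (_ * _)%E; apply: eq_bigr => a _; rewrite fineK//.
  by apply: fin_num_measure; exact: (mY a [set (f a : nat)]).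
rewrite sumEFin /= -mulr_sumr coef_prod_poly; congr (_ * _).
Qed.

(** * Laws of the innovation and of the counting variables *)

Lemma NB1_law (d : measure_display) (T : measurableType d) (R : realType)
    (P : probability T R) (X : {RV P >-> nat}) (m : R) (k : nat) :
  0 <= m -> has_pgf X (NB_pgf 1 m) ->
  fine (P [set w | X w = k]) = (1 + m)^-1 * (1 - (1 + m)^-1) ^+ k.
Proof.
move=> m0 hX; have p0 : 0 < 1 + m by rewrite ltr_pwDl.
move: k; apply: (expands_as_unique (pgf_expands_as hX)).
apply: eq_expands_as (expands_as_geometric _); last first.
  by rewrite invr_gt0 p0 invf_le1// lerDl.
move=> s /andP[s0 s1]; have d0 : 0 < 1 + m * (1 - s) by nra.
rewrite /NB_pgf invr1 mulr1 powR_inv1 ?ltW//; field.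
by rewrite !gt_eqF//; nra.
Qed.

(** With H(s) = s q / (1 - (1 - q) s), one has 1 - H(s) = (1 - s) / (1 - (1 - q) s), so [G_pgf] is 1
    - alpha q + alpha q H(s), a shifted geometric expansion. *)
Lemma counting_law (d : measure_display) (T : measurableType d) (R : realType)
    (P : probability T R) (Y : {RV P >-> nat}) (alpha mu : R) (k : nat) :
  let q := (1 + (1 - alpha) * mu)^-1 in
  alpha < 1 -> 0 < mu -> has_pgf Y (G_pgf alpha mu) ->
  fine (P [set w | Y w = k]) =
  if k is k'.+1 then alpha * q * (q * (1 - q) ^+ k') else 1 - alpha * q.
Proof.
move=> q alpha1 mu0 hY.
have m0 : 0 < (1 - alpha) * mu by rewrite mulr_gt0 ?subr_gt0.
have p0 : 0 < 1 + (1 - alpha) * mu by rewrite addr_gt0.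
move: k; apply: (expands_as_unique (pgf_expands_as hY)).
have q01 : 0 < q <= 1 by rewrite invr_gt0 p0 invf_le1// lerDl ltW.
apply: eq_expands_as (expands_as_shift (1 - alpha * q) (alpha * q)
  (expands_as_geometric q01)) => s /andP[s0 s1].
have d0 : 0 < 1 + (1 - alpha) * mu * (1 - s) by nra.
by rewrite /G_pgf /q; field; rewrite !gt_eqF//; nra.
Qed.

(** * Independence within one time step *)

Lemma mutual_independence_inj (d : measure_display) (T : measurableType d)
    (R : realType) (P : probability T R) (I : choiceType) (K : finType)
    (Y : I -> {RV P >-> nat}) (h : K -> I) (f : K -> nat) :
  mutual_independence Y -> injective h ->
  P (\bigcap_k (Y (h k) @^-1` [set f k])) =
  (\prod_k P (Y (h k) @^-1` [set f k]))%E.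
Proof.
move=> indep hinj.
(* Independence wants sets indexed by [I], while [f] lives on [K]. Quantifying over the preimages of
   [x] avoids inverting [h]; by injectivity these sets are the singletons [[set f k]] on the
   image. *)
have := indep [seq h k | k : K]
  (fun x => [set m | forall k, h k = x -> m = f k]).
rewrite map_inj_uniq ?enum_uniq// => /(_ isT).
rewrite big_map big_enum /= => E.
have YE k : Y (h k) @^-1` [set m | forall k', h k' = h k -> m = f k'] =
    Y (h k) @^-1` [set f k].
  apply/seteqP; split => w /=; first exact.
  by move=> -> k' /hinj ->.
rewrite (eq_bigr (fun k => P (Y (h k) @^-1` [set f k]))) in E; last first.
  by move=> k _; rewrite YE.
rewrite -E; congr (P _); apply/seteqP; split => w Yw /=.
  by move=> _ /= /mapP[k _ ->] k' /hinj ->; exact: Yw.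
move=> k _; have /= := Yw (h k); apply => //.
by apply/mapP; exists k; rewrite ?mem_enum.
Qed.

Definition step_index (i : nat) (a : 'I_i + unit) : option nat :=
  if a is inl k then Some (val k) else None.

Lemma step_index_inj (i : nat) : injective (@step_index i).
Proof. by move=> [k|[]] [l|[]]//= [/val_inj ->]. Qed.

(** Two independences combine: [INAR1_past], used only at the last index [ord_max], splits off
    [X t], and [INAR1_driving] factors the remaining variables. *)
Lemma step_independence (d : measure_display) (T : measurableType d)
    (R : realType) (P : probability T R) (alpha mu : R) (Psi : R -> R)
    (X : nat -> {RV P >-> nat}) (G : nat -> nat -> {RV P >-> nat})
    (eps : nat -> {RV P >-> nat}) (t i : nat) (f : 'I_i + unit -> nat) :
  INAR1 alpha mu Psi X G eps ->
  let Y a := step_driving G eps t (step_index a) in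
  P ([set w | X t w = i] `&` \bigcap_a (Y a @^-1` [set f a])) =
  (P [set w | X t w = i] * \prod_a P (Y a @^-1` [set f a]))%E.
Proof.
move=> hI Y.
pose h (a : 'I_i + unit) : nat * nat + nat :=
  if a is inl k then inl (t, val k) else inr t.
have hinj : injective h by move=> [k|[]] [l|[]]//= [/val_inj ->].
have Yh a : Y a = driving G eps (h a) by case: a.
have := INAR1_past hI (t := t) [seq step_index a | a : 'I_i + unit] [:: ord_max]
  (fun x => [set m | forall a, step_index a = x -> m = f a]) (fun=> [set i]).
set S := \bigcap_(_ in _) _; set S' := \bigcap_(_ in _) _ => E.
have -> : [set w | X t w = i] = S'.
  apply/seteqP; split => w /=.
    by move=> Xw k; rewrite /= inE => /eqP ->.
  by move=> /(_ ord_max) /= ->//; rewrite inE.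
have SE : S = \bigcap_a (Y a @^-1` [set f a]).
  apply/seteqP; split => w Yw /=.
    move=> a _; have /= := Yw (step_index a); apply => //.
    by apply/mapP; exists a; rewrite ?mem_enum.
  by move=> _ /= /mapP[a _ ->] a' /step_index_inj ->; exact: Yw.
rewrite -SE setIC E muleC; congr (_ * _)%E; rewrite SE.
under eq_bigcapr do rewrite Yh.
under eq_bigr do rewrite Yh.
exact: mutual_independence_inj (INAR1_driving hI) hinj.
Qed.

(** * Computation of the transition probabilities *)

Theorem proposition3p1 (d : measure_display) (T : measurableType d)
    (R : realType) (P : probability T R) (alpha mu q : R)
    (halpha0 : 0 < alpha) (halpha1 : alpha < 1) (hmu : 0 < mu)
    (hq : q = (1 + (1 - alpha) * mu)^-1)
    (X : nat -> {RV P >-> nat}) (G : nat -> nat -> {RV P >-> nat})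
    (eps : nat -> {RV P >-> nat})
    (hINAR : INAR1 alpha mu (NB_pgf 1 ((1 - alpha) * mu)) X G eps)
    (hstat : stationary X)
    (hmarg : has_pgf (X 0%N) (NB_pgf 1 mu))
    (t i j : nat) :
  cond_prob P [set w | X t.+1 w = j] [set w | X t w = i] =
  if i == 0%N then q * (1 - q) ^+ j
  else A_coef i 0 (alpha * q) * B_coef j.+1 1 q +
       \sum_(1 <= k < j.+1) B_coef (j - k).+1 1 q *
         \sum_(1 <= l < (minn i k).+1) A_coef i l (alpha * q) * B_coef k l q.
Proof.
have m0 : 0 < (1 - alpha) * mu by rewrite mulr_gt0 ?subr_gt0.
have p0 : 0 < 1 + (1 - alpha) * mu by rewrite addr_gt0.
have epsE k : fine (P [set w | eps t.+1 w = k]) = q * (1 - q) ^+ k.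
  by rewrite (NB1_law _ (ltW m0) (INAR1_innovation hINAR t)) hq.
have GE l k : fine (P [set w | G t l w = k]) =
    if k is k'.+1 then alpha * q * (q * (1 - q) ^+ k') else 1 - alpha * q.
  by rewrite (counting_law _ halpha1 hmu (INAR1_counting hINAR t l)) hq.
have XE : fine (P [set w | X t w = i]) = (1 + mu)^-1 * (1 - (1 + mu)^-1) ^+ i.
  rewrite -(NB1_law _ (ltW hmu) hmarg).
  have := hstat t [:: 0%N] (fun=> [set i]).
  by rewrite !bigcap_seq !big_seq1 add0n => ->.
(* Stationarity serves to show that the conditioning event has positive probability, so that the
   quotient cancels. *)
have XN0 : fine (P [set w | X t w = i]) != 0.
  have mu1 : 1 < 1 + mu by rewrite ltrDl.
  have mu0 : 0 < 1 + mu by apply: lt_trans mu1.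
  have r0 : 0 < 1 - (1 + mu)^-1 by rewrite subr_gt0 invf_lt1.
  by rewrite XE mulf_neq0 ?expf_neq0 ?invr_eq0 ?gt_eqF.
pose Y a := step_driving G eps t (@step_index i a).
(* On [X t = i] the random number of summands is the constant [i], so the next state is a finite sum
   over ['I_i + unit]. *)
have -> : cond_prob P [set w | X t.+1 w = j] [set w | X t w = i] =
    (\prod_a \poly_(m < j.+1) fine (P [set w | Y a w = m]))`_j.
  rewrite /cond_prob.
  have -> : [set w | X t.+1 w = j] `&` [set w | X t w = i] =
      [set w | X t w = i] `&` [set w | (\sum_a Y a w)%N = j].
    have XY w : X t w = i -> X t.+1 w = (\sum_a Y a w)%N.
      move=> Xi; rewrite (INAR1_rec hINAR) /thinning Xi big_sumType /=.
      by rewrite big_const card_unit /= addn0.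
    apply/seteqP; split => w /=; first by move=> [<- Xi]; rewrite XY.
    by move=> [Xi <-]; rewrite XY.
  rewrite prob_sum_eq; first by rewrite mulrC mulKf.
    exact: (measurable_RV_preimage (X t) [set i]).
  move=> f; exact: (step_independence t f hINAR).
have epsP : \poly_(m < j.+1) fine (P [set w | eps t.+1 w = m]) =
    \poly_(m < j.+1) (B_coef m.+1 1 q).
  apply/polyP => m; rewrite !coef_poly; case: ifP => // _.
  by rewrite epsE /B_coef bin0 mul1r expr1 subn1.
have GP l : \poly_(m < j.+1) fine (P [set w | G t l w = m]) =
    (1 - alpha * q)%:P + (alpha * q) *: geometric_poly q j.+1.
  apply/polyP => m; rewrite coefD coefC coefZ !coef_poly GE.
  case: m => [|m] /=; first by rewrite mulr0 addr0.
  by case: ifP; rewrite ?mulr0 add0r.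
rewrite big_sumType /= [X in _ * X](big_pred1 tt) /=; last by case.
rewrite epsP.
rewrite (eq_bigr _ (fun (l : 'I_i) _ => GP l)) prodr_const card_ord.
case: eqP => [->|i0].
  by rewrite expr0 mul1r coef_poly ltnSn /B_coef bin0 mul1r expr1 subn1.
rewrite coefM -(big_mkord xpredT (fun k =>
  (((1 - alpha * q)%:P + (alpha * q) *: geometric_poly q j.+1) ^+ i)`_k *
  (\poly_(m < j.+1) B_coef m.+1 1 q)`_(j - k))).
(* In the convolution, [k] is the thinned total. The term [k = 0], where all counting variables
   vanish, yields the [A_coef i 0] term. *)
rewrite big_nat_recl// subn0 coef0_exp coefD coefZ coef0_geometric_poly.
rewrite mulr0 addr0 coefC coef_poly ltnSn /=; congr (_ + _).
  by rewrite /A_coef bin0 !mul1r subn0.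
rewrite big_add1 /=; apply: eq_big_nat => k /andP[_ kj].
by rewrite coef_zero_modified_exp// coef_poly ltnS leq_subr mulrC.
Qed.
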